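(* Let $(S,\mathcal{F})$ be a saturated fusion system over a finite $p$-group $S$. The family $\mathcal{K}=\{K_n\}_{n\ge0}$ given by $$K_n=\Big\{[Q_0<\cdots<Q_n]\in\mathrm{Ob}_n([\mathcal{S}_\lhd(\mathcal{F})]^{op})\ \Big|\ [Q_0<\cdots<Q_n]=[Q'_0<\cdots<Q'_n]\Rightarrow\bigcap_{i=0}^nN_S(Q'_i)=Q'_n\Big\}$$ is a global covering family for the graded poset $[\mathcal{S}_\lhd(\mathcal{F})]^{op}$.
   Context: Fusion systems. A fusion system $\mathcal{F}$ over a finite $p$-group $S$ is a category whose objects are the subgroups of $S$, whose morphism sets $\mathrm{Hom}_{\mathcal{F}}(P,Q)$ consist of injective homomorphisms and contain all those induced by conjugation by elements of $S$, and in which every morphism is an $\mathcal{F}$-isomorphism followed by an inclusion. $P$ is fully normalized (resp. fully centralized) if $|N_S(P)|\ge|N_S(P')|$ (resp. $|C_S(P)|\ge|C_S(P')|$) for all $P'$ $\mathcal{F}$-isomorphic to $P$. $\mathcal{F}$ is saturated if every fully normalized $P$ is fully centralized with $\mathrm{Aut}_S(P)$ a Sylow $p$-subgroup of $\mathrm{Aut}_{\mathcal{F}}(P)$, and every $\varphi\in\mathrm{Hom}_{\mathcal{F}}(P,S)$ with $\varphi(P)$ fully centralized extends to a morphism in $\mathcal{F}$ on $N_\varphi=\{g\in N_S(P)\mid\varphi c_g\varphi^{-1}\in\mathrm{Aut}_S(\varphi(P))\}$. The poset $[\mathcal{S}_\lhd(\mathcal{F})]$. Its objects are the $\mathcal{F}$-isomorphism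 classes $[Q_0<Q_1<\cdots<Q_n]$, $n\ge0$, of chains of subgroups of $S$ with $Q_i\lhd Q_n$ for $i=0,\ldots,n$, where $[Q_0<\cdots<Q_n]=[Q'_0<\cdots<Q'_n]$ iff there is an $\mathcal{F}$-isomorphism $\varphi:Q_n\to Q'_n$ with $\varphi(Q_i)=Q'_i$ for all $i$. The objects $\le[Q_0<\cdots<Q_n]$ are the classes $[Q_{i_0}<\cdots<Q_{i_m}]$ of non-empty subchains. The opposite poset is graded with $\deg[Q_0<\cdots<Q_n]=n$. Graded posets. Write $\mathcal{P}=[\mathcal{S}_\lhd(\mathcal{F})]^{op}$, regarded as a category with one arrow $p\to p'$ if $p\le p'$. $\mathrm{Ob}_n(\mathcal{P})$ is the set of objects of degree $n$ and $(p_0\downarrow\mathcal{P})_n=\{p\mid p_0\le p,\ \deg p=n\}$. (There exists an adequate local covering family for $\mathcal{P}$ in the paper's sense, so the following notions apply.) Functors $F_n:\mathcal{P}\to\mathrm{Ab}$: $F_0$ is the constant functor $\mathbb{Z}$, and for $n\ge1$, $F_n(p_0)$ is the cokernel of the map $F_{n-1}(p_0)\to\prod_{p\in(p_0\downarrow\mathcal{P})_{n-1}}F_{n-1}(p)$ with components $F_{n-1}(p_0\to p)$; arrows act by the maps induced by projections. Define $d_n:\prod_{p\in\mathrm{Ob}_n(\mathcal{P})}F_n(p)\to\prod_{q\in\mathrm{Ob}_{n+1}(\mathcal{P})}F_{n+1}(q)$ by letting $d_n(x)_q$ be the class of $(x_p)_{p\in(q\downarrow\mathcal{P})_n}$ in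 $F_{n+1}(q)$. Global covering families. A homomorphism is pure if its cokernel is a free abelian group. A global covering family for $\mathcal{P}$ is a family $\{K_n\}_{n\ge0}$ with $K_n\subseteq\mathrm{Ob}_n(\mathcal{P})$ such that (1) the restriction map $\varprojlim F_n\to\prod_{p\in K_n}F_n(p)$ is injective for each $n\ge0$; (2) for each $n\ge1$ the map $\prod_{p\in\mathrm{Ob}_{n-1}(\mathcal{P})\setminus K_{n-1}}F_{n-1}(p)\to\prod_{p\in K_n}F_n(p)$, obtained from $d_{n-1}$ by precomposing with the inclusion (extension by zero) and postcomposing with the projection, is pure. *)

(* Defs.v *)
From HB Require Import structures.
From mathcomp Require Import all_boot all_order all_algebra all_fingroup all_solvable.
From mathcomp Require Import generic_quotient ring_quotient boolp.
From mathcomp Require freeg.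

Set Implicit Arguments.
Unset Strict Implicit.
Unset Printing Implicit Defensive.

Import Order.TTheory GRing.Theory.

Local Open Scope quotient_scope.

Section Fusion.
Local Open Scope group_scope.
Variable gT : finGroupType.
Implicit Types (S P Q R : {group gT}) (f g h : gT -> gT).

Section HomIso.
Variable Hom : {group gT} -> {group gT} -> (gT -> gT) -> Prop.

Definition hom_iso P Q f : Prop :=
  Hom P Q f /\
  exists g, [/\ Hom Q P g, {in P, cancel f g} & {in Q, cancel g f}].
End HomIso.

(* As for {morphism P >-> gT}, an arrow P -> Q is given by a function on the
   whole of gT of which only the values on P matter ([hom_ext]); [Hom P Q f]
   says that f represents an arrow.  Identities and inclusions are the arrows
   [hom_conj] for the unit element of S. *)
Record fusion_system (S : {group gT}) := FusionSystem {
  Hom : {group gT} -> {group gT} -> (gT -> gT) -> Prop;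
  hom_sub : forall P Q f, Hom P Q f -> P \subset S /\ Q \subset S;
  hom_ext : forall P Q f g, {in P, f =1 g} -> Hom P Q f -> Hom P Q g;
  hom_inj : forall P Q f, Hom P Q f ->
    [/\ {in P &, {morph f : x y / x * y}}, {in P &, injective f}
      & f @: P \subset Q];
  hom_comp : forall P Q R f g, Hom P Q f -> Hom Q R g -> Hom P R (g \o f);
  hom_conj : forall P Q x, P \subset S -> Q \subset S -> x \in S ->
    P :^ x \subset Q -> Hom P Q (conjg^~ x);
  hom_fact : forall P Q f, Hom P Q f ->
    exists R : {group gT}, R \subset Q /\ hom_iso Hom P R f
}.

Variables (S : {group gT}) (F : fusion_system S).

Definition isoF P Q f : Prop := hom_iso (Hom F) P Q f.

Definition isomorphic P Q : Prop := exists f, isoF P Q f.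

Definition fully_normalized P : Prop :=
  P \subset S /\
  forall Q, isomorphic P Q -> #|'N_S(Q)| <= #|'N_S(P)|.

Definition fully_centralized P : Prop :=
  P \subset S /\
  forall Q, isomorphic P Q -> #|'C_S(Q)| <= #|'C_S(P)|.

Definition AutS P : {set {perm gT}} := conj_aut P @* 'N_S(P).

Definition AutF P : {set {perm gT}} := [set a in Aut P | `[< Hom F P P a >]].

(* g is in N_f when f c_g f^-1 = c_h on f(P) for some h in N_S(f(P)). *)
Definition Nphi P f : {set gT} :=
  [set g in 'N_S(P) | [exists h in 'N_S(f @: P),
     [forall x in P, f (x ^ g) == f x ^ h]]].

Lemma Nphi_group_set P f : group_set (Nphi P f).
Proof.
apply/group_setP; split.
  rewrite inE group1; apply/exists_inP; exists 1; first exact: group1.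
  by apply/forall_inP => x _; rewrite !conjg1.
move=> g1 g2; rewrite inE => /andP[N1 /exists_inP[h1 H1 /forall_inP E1]].
rewrite inE => /andP[N2 /exists_inP[h2 H2 /forall_inP E2]].
rewrite inE (groupM N1 N2); apply/exists_inP; exists (h1 * h2).
  by rewrite groupM.
apply/forall_inP => x Px; rewrite !conjgM -(eqP (E1 x Px)); apply: E2.
by rewrite memJ_norm //; case/setIP: N1.
Qed.
Canonical Nphi_group P f := Group (Nphi_group_set P f).

Definition saturated (p : nat) : Prop :=
  (forall P, fully_normalized P ->
     fully_centralized P /\ p.-Sylow(AutF P) (AutS P)) /\
  (forall P R f, Hom F P S f -> f @: P = R -> fully_centralized R ->
     exists2 f', Hom F (Nphi_group P f) S f' & {in P, f' =1 f}).

Lemma hom_incl P Q : P \subset Q -> Q \subset S -> Hom F P Q id.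
Proof.
move=> PQ QS; have PS := subset_trans PQ QS.
apply: (@hom_ext _ F _ _ (conjg^~ 1)); first by move=> x _ /=; rewrite conjg1.
by apply: hom_conj => //; rewrite conjsg1.
Qed.

Lemma isoF_refl P : P \subset S -> isoF P P id.
Proof. by move=> PS; split; [|exists id; split]; rewrite //; apply: hom_incl. Qed.

Lemma isoF_sym P Q f : isoF P Q f -> exists g,
  [/\ isoF Q P g, {in P, cancel f g} & {in Q, cancel g f}].
Proof.
by case=> Hf [g [Hg fK gK]]; exists g; split => //; split => //; exists f; split.
Qed.

Lemma isoF_im P Q f : isoF P Q f -> f @: P = Q.
Proof.
case=> /hom_inj[_ _ fPQ] [g [/hom_inj[_ _ gQP] _ gK]].
apply/eqP; rewrite eqEsubset fPQ; apply/subsetP => y Qy.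
by rewrite -(gK y Qy) imset_f // (subsetP gQP) // imset_f.
Qed.

Lemma isoF_trans P Q R f g : isoF P Q f -> isoF Q R g -> isoF P R (g \o f).
Proof.
move=> If Ig; case: (If) => Hf [f' [Hf' fK f'K]].
case: (Ig) => Hg [g' [Hg' gK g'K]]; split; first exact: hom_comp Hg.
have [_ _ fPQ] := hom_inj Hf; have [_ _ gQP] := hom_inj Hg'.
exists (f' \o g'); split; first exact: hom_comp Hf'.
  by move=> x Px /=; rewrite gK ?fK // (subsetP fPQ) ?imset_f.
by move=> x Rx /=; rewrite f'K ?g'K // (subsetP gQP) ?imset_f.
Qed.

Lemma isoF_restr P Q P' Q' f :
  isoF P Q f -> P' \subset P -> f @: P' = Q' -> isoF P' Q' f.
Proof.
move=> If sP' eQ'; have [Hf _] := If; have [PS _] := hom_sub Hf.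
have Hf' : Hom F P' Q f := hom_comp (hom_incl sP' PS) Hf.
have [R [_ IR]] := hom_fact Hf'.
by have -> : Q' = R by apply: val_inj; rewrite /= -eQ' (isoF_im IR).
Qed.

Lemma AutF_group_set P : P \subset S -> group_set (AutF P).
Proof.
move=> PS; apply/group_setP; split.
  rewrite inE group1; apply/asboolP.
  by apply: hom_ext (hom_incl (subxx P) PS) => x _; rewrite perm1.
move=> a b; rewrite inE => /andP[Aa /asboolP Ha].
rewrite inE => /andP[Ab /asboolP Hb]; rewrite inE groupM //; apply/asboolP.
by apply: hom_ext (hom_comp Ha Hb) => x _; rewrite permM.
Qed.

Definition top (c : seq {group gT}) : {group gT} := last 1%G c.

Definition is_chain (c : seq {group gT}) : bool :=
  [&& c != [::], sorted (fun P Q : {group gT} => P \proper Q) c,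
      all (fun Q : {group gT} => Q <| top c) c & top c \subset S].

Record chain := Chain { chain_seq :> seq {group gT}; _ : is_chain chain_seq }.

HB.instance Definition _ := [isSub for chain_seq].
HB.instance Definition _ := [Choice of chain by <:].

Lemma chainP (c : chain) : is_chain c. Proof. by case: c. Qed.

(* Q_n is [top c]; the images f(Q_i) are compared entrywise with the Q'_i. *)
Definition chain_iso (c c' : chain) : Prop := exists2 f,
  isoF (top c) (top c') f &
  [seq f @: (Q : {set gT}) | Q : {group gT} <- c]
    = [seq (Q : {set gT}) | Q : {group gT} <- c'].

Lemma top_sub (c : chain) : top c \subset S.
Proof. by have /and4P[] := chainP c. Qed.

Lemma top_max (c : chain) (Q : {group gT}) : Q \in (c : seq _) -> Q \subset top c.
Proof.
by have /and4P[_ _ /allP cn _] := chainP c; move/cn; apply: normal_sub.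
Qed.

Lemma chain_iso_refl c : chain_iso c c.
Proof.
exists id; first exact: isoF_refl (top_sub c).
by apply: eq_map => Q; rewrite imset_id.
Qed.

Lemma chain_iso_sym c c' : chain_iso c c' -> chain_iso c' c.
Proof.
case=> f If E; have [g [Ig fK gK]] := isoF_sym If; exists g => //.
have -> : [seq g @: (Q : {set gT}) | Q : {group gT} <- c']
   = [seq g @: (X : {set gT}) | X <- [seq (Q : {set gT}) | Q : {group gT} <- c']].
  by rewrite -map_comp.
rewrite -E -map_comp; apply/eq_in_map => Q Qc /=.
rewrite -imset_comp -[RHS]imset_id; apply: eq_in_imset => x Qx /=.
by rewrite fK // (subsetP (top_max Qc)).
Qed.

Lemma chain_iso_trans c c' c'' :
  chain_iso c c' -> chain_iso c' c'' -> chain_iso c c''.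
Proof.
case=> f If E [g Ig E']; exists (g \o f); first exact: isoF_trans Ig.
have -> : [seq (g \o f) @: (Q : {set gT}) | Q : {group gT} <- c]
   = [seq g @: (X : {set gT}) | X <-
       [seq f @: (Q : {set gT}) | Q : {group gT} <- c]].
  by rewrite -map_comp; apply: eq_map => Q /=; rewrite imset_comp.
by rewrite E -E' -map_comp.
Qed.

Lemma chain_iso_size c c' : chain_iso c c' -> size c = size c'.
Proof. by case=> f _ /(congr1 size); rewrite !size_map. Qed.

Definition chain_rel : rel chain := fun c c' => `[< chain_iso c c' >].

Lemma chain_rel_equiv : equiv_class_of chain_rel.
Proof.
split=> [c|c c'|c' c c''].
- exact/asboolP/chain_iso_refl.
- by apply/asboolP/asboolP; apply: chain_iso_sym.
- by move=> /asboolP H /asboolP H'; apply/asboolP; apply: chain_iso_trans H'.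
Qed.
Canonical chain_equiv := EquivRelPack chain_rel_equiv.
Canonical chain_encModRel := defaultEncModRel chain_rel.

Definition chain_class := {eq_quot chain_rel}.
HB.instance Definition _ := EqQuotient.on chain_class.
HB.instance Definition _ := Choice.on chain_class.

Lemma chain_classP c c' :
  reflect (chain_iso c c') (\pi_chain_class c == \pi_chain_class c').
Proof. by rewrite piE; apply: asboolP. Qed.

(* Isomorphic chains have the same length, see [chain_degE]. *)
Definition chain_deg (x : chain_class) : nat := (size (repr x)).-1.

Lemma chain_degE c : chain_deg (\pi_chain_class c) = (size c).-1.
Proof.
rewrite /chain_deg; congr _.-1; apply: chain_iso_size.
by apply/chain_classP; rewrite reprK.
Qed.

Definition chain_le (x y : chain_class) : bool :=
  `[< exists c c', [/\ x = \pi_chain_class c, y = \pi_chain_class c'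
                     & subseq c c'] >].

Lemma proper_trans_rel : transitive (fun P Q : {group gT} => P \proper Q).
Proof. by move=> P Q R; apply: proper_trans. Qed.

Lemma subchain (c : chain) (s : seq {group gT}) :
  s != [::] -> subseq s c -> is_chain s.
Proof.
move=> s0 sc; have /and4P[_ c_s /allP cn cS] := chainP c.
have topc : top s \in (c : seq _).
  by apply: (mem_subseq sc); case: s s0 {sc} => // Q s _; rewrite /top /= mem_last.
have s_s := subseq_sorted proper_trans_rel sc c_s.
rewrite /is_chain s0 s_s /= (subset_trans (top_max topc) cS) andbT.
apply/allP => Q Qs; have nQ := cn _ (mem_subseq sc Qs).
apply: normalS (top_max topc) nQ.
case/splitPr: Qs s_s => s1 s2; rewrite /top last_cat /=.
rewrite (sorted_pairwise proper_trans_rel) pairwise_cat pairwise_cons.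
case/and3P=> _ _ /andP[/allP H _].
have := mem_last Q s2; rewrite inE => /orP[/eqP->//|/H]; exact: proper_sub.
Qed.

Lemma chain_le_refl : reflexive chain_le.
Proof. by move=> x; apply/asboolP; exists (repr x), (repr x); rewrite reprK. Qed.

Lemma chain_le_anti : antisymmetric chain_le.
Proof.
move=> x y /andP[/asboolP[c [c' [ex ey sc]]] /asboolP[d [d' [ey' ex' sd]]]].
have szE (a b : chain) : \pi_chain_class a = \pi_chain_class b -> size a = size b.
  by move/eqP/chain_classP/chain_iso_size.
have e1 : size c = size d' by apply: szE; rewrite -ex.
have e2 : size c' = size d by apply: szE; rewrite -ey.
have := size_subseq_leqif sc; have := size_subseq sd.
rewrite -e1 -e2 => le1 [le2]; rewrite eqn_leq le1 le2 => /esym/eqP cc.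
by rewrite ex ey; congr (\pi _); apply: val_inj.
Qed.

Lemma top_map f (c s : seq {group gT}) : c != [::] ->
  [seq f @: (Q : {set gT}) | Q : {group gT} <- c]
    = [seq (Q : {set gT}) | Q : {group gT} <- s] ->
  f @: top c = top s.
Proof.
case: c => // Q q _; case: s => // T t /= [E1 E2]; rewrite /top /=.
rewrite -(last_map (fun P : {group gT} => f @: P)).
by rewrite -(last_map (fun P : {group gT} => P : {set gT})) E1 E2.
Qed.

Lemma chain_le_trans : transitive chain_le.
Proof.
move=> y x z /asboolP[c [c' [ex ey sc]]] /asboolP[d [e [ey' ez sd]]].
have /chain_classP[f If E] : \pi_chain_class c' == \pi_chain_class d.
  by rewrite -ey ey'.
have /subseqP[m szm cE] := sc.
have szd : size c' = size d by move: (congr1 size E); rewrite !size_map.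
pose s := mask m d.
have sd' : subseq s d by apply: mask_subseq.
have Es : [seq f @: (Q : {set gT}) | Q : {group gT} <- c]
    = [seq (Q : {set gT}) | Q : {group gT} <- s].
  by rewrite /s cE !map_mask E.
have s0 : s != [::].
  rewrite -size_eq0 -(size_map (fun Q : {group gT} => Q : {set gT})) -Es size_map.
  by rewrite size_eq0; have /and4P[] := chainP c.
pose sC := Chain (subchain s0 sd').
apply/asboolP; exists sC, e; split => //; last exact: subseq_trans sd.
rewrite ex; apply/eqP/chain_classP; exists f => //.
have topc : top c \in (c : seq _).
  have /and4P[] := chainP c; case: (c : seq _) => // Q s' _ _ _ _.
  by rewrite /top /= mem_last.
apply: (isoF_restr If); first exact/top_max/(mem_subseq sc).
by have /and4P[c0 _ _ _] := chainP c; apply: top_map.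
Qed.

HB.instance Definition _ := Order.Le_isPOrder.Build (Order.Disp tt tt)
  chain_class chain_le_refl chain_le_anti chain_le_trans.

End Fusion.

Local Open Scope ring_scope.

Module FreeAbelian.
Import freeg.
Definition free_abelian (V : zmodType) : Prop :=
  exists (K : choiceType) (f : {additive {freeg K} -> V}), bijective f.
End FreeAbelian.
Export FreeAbelian.

Section DProd.
Variables (I : Type) (V : I -> zmodType).

Definition dprod : Type := forall i, V i.

HB.instance Definition _ := Choice.on dprod.

Definition dprod_zero : dprod := fun=> 0.
Definition dprod_opp (x : dprod) : dprod := fun i => - x i.
Definition dprod_add (x y : dprod) : dprod := fun i => x i + y i.

Lemma dprod_addA : associative dprod_add.
Proof. by move=> x y z; apply: functional_extensionality_dep => i; apply: addrA. Qed.
Lemma dprod_addC : commutative dprod_add.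
Proof. by move=> x y; apply: functional_extensionality_dep => i; apply: addrC. Qed.
Lemma dprod_add0 : left_id dprod_zero dprod_add.
Proof. by move=> x; apply: functional_extensionality_dep => i; apply: add0r. Qed.
Lemma dprod_addN : left_inverse dprod_zero dprod_opp dprod_add.
Proof. by move=> x; apply: functional_extensionality_dep => i; apply: addNr. Qed.

HB.instance Definition _ :=
  GRing.isZmodule.Build dprod dprod_addA dprod_addC dprod_add0 dprod_addN.

Lemma dprodDE (x y : dprod) i : (x + y) i = x i + y i. Proof. by []. Qed.
Lemma dprodBE (x y : dprod) i : (x - y) i = x i - y i. Proof. by []. Qed.
Lemma dprod0E i : (0 : dprod) i = 0. Proof. by []. Qed.
End DProd.

Section Coker.
Variables (A B : zmodType) (f : {additive A -> B}).

Definition im_pred : {pred B} := fun y => `[< exists x, y = f x >].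

Lemma im_pred_zmod_closed : zmod_closed im_pred.
Proof.
split; first by apply/asboolP; exists 0; rewrite raddf0.
move=> _ _ /asboolP[x ->] /asboolP[y ->]; apply/asboolP.
by exists (x - y); rewrite raddfB.
Qed.
HB.instance Definition _ := GRing.isZmodClosed.Build B im_pred im_pred_zmod_closed.

Definition coker : zmodType := Quotient.quot im_pred.

Definition coker_pi : {additive B -> coker} := \pi_(Quotient.quot im_pred).

Lemma coker_piP x y : coker_pi x = coker_pi y <-> exists z, x - y = f z.
Proof.
split=> [/eqP|H].
  by rewrite /coker_pi /= -Quotient.idealrBE => /asboolP.
by apply/eqP; rewrite /coker_pi /= -Quotient.idealrBE; apply/asboolP.
Qed.
End Coker.

Definition pure (A B : zmodType) (f : {additive A -> B}) : Prop :=
  free_abelian (coker f).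

Section CokerMap.
Variables (A B A' B' : zmodType) (f : {additive A -> B}) (f' : {additive A' -> B'}).
Variables (a : {additive A -> A'}) (b : {additive B -> B'}).
Hypothesis comm : forall x, b (f x) = f' (a x).

Definition coker_fun (u : coker f) : coker f' := coker_pi f' (b (repr u)).

Lemma coker_fun_pi y : coker_fun (coker_pi f y) = coker_pi f' (b y).
Proof.
have [z E] : exists z, repr (coker_pi f y) - y = f z.
  by apply/coker_piP; rewrite {1}/coker_pi /= reprK.
by apply/coker_piP; exists (a z); rewrite -comm -E raddfB.
Qed.

Lemma coker_fun_additive : zmod_morphism coker_fun.
Proof.
move=> u v; rewrite -[u]reprK -[v]reprK.
have E y : \pi_(Quotient.quot (im_pred f)) y = coker_pi f y by [].
by rewrite !E -raddfB !coker_fun_pi !raddfB.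
Qed.

Definition coker_map : {additive coker f -> coker f'} :=
  HB.pack coker_fun (GRing.isZmodMorphism.Build _ _ coker_fun coker_fun_additive).
End CokerMap.

Section Graded.
Variables (disp : Order.disp_t) (P : porderType disp).

(* A poset is a category with one arrow p -> q whenever p <= q. *)
Record functor := Functor {
  fobj :> P -> zmodType;
  farr : forall p q, (p <= q)%O -> {additive fobj p -> fobj q};
  farr_id : forall p (h : (p <= p)%O) x, farr h x = x;
  farr_comp : forall p q r (h : (p <= q)%O) (h' : (q <= r)%O) (h'' : (p <= r)%O) x,
    farr h' (farr h x) = farr h'' x
}.

Definition constZ : functor :=
  @Functor (fun=> int) (fun _ _ _ => idfun) (fun _ _ _ => erefl)
    (fun _ _ _ _ _ _ _ => erefl).

Definition limit (F : functor) : Type :=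
  {x : dprod F | forall p q (h : (p <= q)%O), farr F h (x p) = x q}.

Variable deg : P -> nat.

Definition Ob (n : nat) : Type := {p : P | deg p == n}.

(* The elements of degree n of the under-category of p0. *)
Definition over (p0 : P) (n : nat) : Type := {p : P | (p0 <= p)%O && (deg p == n)}.

Section Next.
Variables (F : functor) (n : nat).

Lemma over_le p0 (p : over p0 n) : (p0 <= val p)%O.
Proof. by case: p => p /= /andP[]. Qed.

Definition over_Ob p0 (p : over p0 n) : Ob n := exist _ (val p) (andP (valP p)).2.

Lemma over_mono_subproof p q (h : (p <= q)%O) (r : over q n) :
  (p <= val r)%O && (deg (val r) == n).
Proof. by case: r => r /= /andP[qr ->]; rewrite (le_trans h qr). Qed.

Definition over_mono p q (h : (p <= q)%O) (r : over q n) : over p n :=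
  exist _ (val r) (over_mono_subproof h r).

Definition prod_over (p0 : P) : zmodType := dprod (fun p : over p0 n => F (val p)).

Definition diag (p0 : P) (x : F p0) : prod_over p0 := fun p => farr F (over_le p) x.

Lemma diag_additive p0 : zmod_morphism (@diag p0).
Proof.
by move=> x y; apply: functional_extensionality_dep => p; apply: raddfB.
Qed.
HB.instance Definition _ p0 :=
  GRing.isZmodMorphism.Build (F p0) (prod_over p0) (@diag p0) (@diag_additive p0).

Definition proj_over p q (h : (p <= q)%O) (x : prod_over p) : prod_over q :=
  fun r => x (over_mono h r).

Lemma proj_over_additive p q (h : (p <= q)%O) : zmod_morphism (proj_over h).
Proof. by []. Qed.
HB.instance Definition _ p q (h : (p <= q)%O) :=
  GRing.isZmodMorphism.Build (prod_over p) (prod_over q) (proj_over h)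
    (@proj_over_additive p q h).

Lemma proj_over_diag p q (h : (p <= q)%O) x :
  proj_over h (diag x) = diag (farr F h x).
Proof.
by apply: functional_extensionality_dep => r; symmetry; apply: farr_comp.
Qed.

Definition next_obj (p : P) : zmodType := coker (@diag p).

Definition next_arr p q (h : (p <= q)%O) : {additive next_obj p -> next_obj q} :=
  coker_map (proj_over_diag h).

Lemma next_arr_pi p q (h : (p <= q)%O) x :
  next_arr h (coker_pi (@diag p) x) = coker_pi (@diag q) (proj_over h x).
Proof. exact: (coker_fun_pi (proj_over_diag h)). Qed.

Lemma coker_repr p (u : next_obj p) : u = coker_pi (@diag p) (repr u).
Proof. by rewrite /coker_pi /= reprK. Qed.

Lemma next_arr_id p (h : (p <= p)%O) x : next_arr h x = x.
Proof.
rewrite [x]coker_repr next_arr_pi; congr (coker_pi _ _).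
apply: functional_extensionality_dep => r; rewrite /proj_over.
case: r => r hr; rewrite /over_mono /=.
by move: (over_mono_subproof _ _) => /= hr'; rewrite (bool_irrelevance hr' hr).
Qed.

Lemma next_arr_comp p q r (h : (p <= q)%O) (h' : (q <= r)%O) (h'' : (p <= r)%O) x :
  next_arr h' (next_arr h x) = next_arr h'' x.
Proof.
rewrite [x]coker_repr !next_arr_pi; congr (coker_pi _ _).
apply: functional_extensionality_dep => s; rewrite /proj_over /over_mono /=.
move: (over_mono_subproof h _) (over_mono_subproof h'' _) => /= hs hs'.
by rewrite (bool_irrelevance hs hs').
Qed.

Definition next : functor := Functor next_arr_id next_arr_comp.
End Next.

(* [next G m] sends p0 to the cokernel of
   G(p0) -> prod of the G(p), p >= p0 of degree m. *)
Fixpoint Fn (n : nat) : functor := if n is m.+1 then next (Fn m) m else constZ.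

Definition prod_Ob (n : nat) : zmodType := dprod (fun p : Ob n => Fn n (val p)).

Definition dn (n : nat) (x : prod_Ob n) : prod_Ob n.+1 :=
  fun q => coker_pi (@diag (Fn n) n (val q)) (fun p => x (over_Ob p)).

Lemma dn_additive n : zmod_morphism (@dn n).
Proof.
move=> x y; apply: functional_extensionality_dep => q.
exact: (raddfB (coker_pi _)).
Qed.
HB.instance Definition _ n :=
  GRing.isZmodMorphism.Build (prod_Ob n) (prod_Ob n.+1) (@dn n) (@dn_additive n).

Section Restriction.
Variables (n : nat) (K : pred (Ob n)).

Definition prod_in : zmodType := dprod (fun p : {p : Ob n | K p} => Fn n (val (val p))).

Definition restrict (x : prod_Ob n) : prod_in := fun p => x (val p).

Lemma restrict_additive : zmod_morphism restrict. Proof. by []. Qed.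
HB.instance Definition _ :=
  GRing.isZmodMorphism.Build (prod_Ob n) prod_in restrict restrict_additive.

Definition extend0 (x : prod_in) : prod_Ob n := fun p =>
  match @idP (K p) with
  | ReflectT Kp => x (exist _ p Kp)
  | ReflectF _ => 0
  end.

Lemma extend0_additive : zmod_morphism extend0.
Proof.
move=> x y; apply: functional_extensionality_dep => p.
rewrite dprodBE /extend0; case: {-}_ / idP => // _; by rewrite subr0.
Qed.
HB.instance Definition _ :=
  GRing.isZmodMorphism.Build prod_in (prod_Ob n) extend0 extend0_additive.

Definition limit_restrict (x : limit (Fn n)) : prod_in := fun p => sval x (val (val p)).
End Restriction.

(* From the product over the complement of K_n to the product over K_(n+1). *)
Definition dK (K : forall n, pred (Ob n)) (n : nat) :
    {additive prod_in (predC (K n)) -> prod_in (K n.+1)} :=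
  @restrict n.+1 (K n.+1) \o (@dn n \o @extend0 n (predC (K n))).

Definition global_covering_family (K : forall n, pred (Ob n)) : Prop :=
  (forall n, injective (@limit_restrict n (K n))) /\
  (forall n, pure (dK K n)).

End Graded.

Definition chain_poset (gT : finGroupType) (S : {group gT}) (F : fusion_system S) :=
  ((chain_class F)^d)%type.

Definition chain_poset_deg (gT : finGroupType) (S : {group gT})
    (F : fusion_system S) : chain_poset F -> nat :=
  @chain_deg gT S F.

Definition chain_K (gT : finGroupType) (S : {group gT}) (F : fusion_system S)
    (n : nat) : pred (Ob (@chain_poset_deg gT S F) n) :=
  fun x => `[< forall c : chain S, \pi_(chain_class F) c = val x ->
    (\bigcap_(Q <- (c : seq {group gT})) 'N_S(Q) = top c)%g >].

(* Main.v *)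
(* For p in P of degree m, the objects above p are the faces of an m-simplex, one
   for each non-empty set of orders |Q_i|.  By induction on n, F_n(p) is the product
   of F_n over the n-faces containing the top vertex Q_m; hence F_n(p) is Z when
   deg p = n, and for deg p = n+1 the face x of p omitting the top vertex gives an
   isomorphism F_n(x) -> F_{n+1}(p).

   A class x of Ob_n outside K_n has a representative for which the intersection
   N of the N_S(Q_i) is as large as possible; appending N gives a class up(x) in
   K_{n+1}.  Every n-face of up(x) other than x has a top subgroup of order |N|,
   larger than that of x.  So the part of d_n with columns outside K_n and rows
   up(x) is triangular for the order of the top subgroup, with isomorphisms on the
   diagonal.  A compatible family vanishing on K_n is therefore zero, and the
   cokernel in (2) is the product of F_{n+1} over the elements of K_{n+1} not of the
   form up(x), that is, a finite power of Z. *)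
From HB Require Import structures.
From mathcomp Require Import all_boot all_order all_algebra all_fingroup all_solvable.
From mathcomp Require Import generic_quotient boolp.
From mathcomp Require freeg.
Require Import Defs.

Set Implicit Arguments.
Unset Strict Implicit.
Unset Printing Implicit Defensive.

Import Order.TTheory GRing.Theory.
Local Open Scope ring_scope.

(** * Auxiliary facts on sequences and products of abelian groups *)

Lemma uniq_map_inj (T U : eqType) (f : T -> U) (s : seq T) :
  uniq (map f s) -> {in s &, injective f}.
Proof.
move=> fs_uniq x y sx sy fxy; rewrite -(nth_index x sx) -(nth_index x sy).
congr nth; apply/eqP; have nth_f z : z \in s -> nth (f x) (map f s) (index z s) = f z.
  by move=> sz; rewrite (nth_map x) ?index_mem ?nth_index.
by rewrite -(nth_uniq (f x) _ _ fs_uniq) ?size_map ?index_mem // !nth_f // fxy.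
Qed.

(** The recursion of [subseq] read from the right end, where the top vertex of a simplex sits. *)
Lemma subseq_rcons_rcons (T : eqType) (s t : seq T) (x y : T) :
  subseq (rcons s x) (rcons t y) =
    if x == y then subseq s t else subseq (rcons s x) t.
Proof.
by rewrite -subseq_rev !rev_rcons /=; case: eqP => _; rewrite -?rev_rcons subseq_rev.
Qed.

Lemma dprodMzE (I : Type) (V : I -> zmodType) (x : dprod V) (c : int) i :
  (x *~ c) i = x i *~ c.
Proof.
have natE n : (x *+ n) i = x i *+ n.
  by elim: n => // n IH; rewrite !mulrS dprodDE IH.
by case: c => n; rewrite -?pmulrn ?NegzE ?mulrNz -?pmulrn -?natE.
Qed.

Lemma dn_coker_pi (disp : Order.disp_t) (P : porderType disp) (deg : P -> nat) n
    (X : prod_Ob deg n) t (y : prod_over deg (Fn deg n) n (val t)) :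
  (forall p, X (over_Ob p) = y p) ->
  dn X t = coker_pi (@diag _ _ deg (Fn deg n) n _) y.
Proof.
by move=> Xy; congr (coker_pi _ _); apply: functional_extensionality_dep.
Qed.

(** * Freeness from finitely many integer coordinates *)

Section FreeFin.
Import freeg.

(** Since [s] exhausts [L], every function [L -> int] has finite support and is the coefficient
    function of an element of [{freeg L}]. *)
Lemma free_abelian_fin (L : choiceType) (s : seq L) (V : zmodType)
    (f : (L -> int) -> V) :
  (forall l, l \in s) ->
  (forall a b, f (fun l => a l - b l) = f a - f b) ->
  (forall a b, f a = f b -> a =1 b) ->
  (forall v, exists a, v = f a) ->
  free_abelian V.
Proof.
move=> s_full fB f_inj f_surj.
pose h (D : {freeg L}) := f (fun l => coeff l D).
have h_additive : zmod_morphism h.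
  move=> D E; rewrite /h -fB; congr f; apply: functional_extensionality_dep => l.
  exact: raddfB.
pose H : {additive {freeg L} -> V} :=
  HB.pack h (GRing.isZmodMorphism.Build _ _ h h_additive).
have H_inj : injective H by move=> D E /f_inj DE; apply/eqP/freeg_eqP => l.
have H_surj v : exists D, v = H D.
  have [a ->] := f_surj v; exists (\sum_(l <- undup s) << a l *g l >>).
  congr f; apply: functional_extensionality_dep => l.
  rewrite raddf_sum /= (bigD1_seq l) ?undup_uniq ?mem_undup //= coeffU eqxx mulr1.
  by rewrite big1 ?addr0 // => l' /negPf ne; rewrite coeffU ne mulr0.
exists L, H; exists (fun v => projT1 (cid (H_surj v))) => x.
  by apply: H_inj; case: cid => y /= <-.
by case: cid => y /= <-.
Qed.
End FreeFin.

(** * Extension of partial families by zero *)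

Section Extension.
Variables (disp : Order.disp_t) (P : porderType disp) (deg : P -> nat) (n : nat).
Variables (K : pred (Ob deg n)) (x : prod_in K).

Lemma extend0_in p : extend0 x (val p) = x p.
Proof.
case: p => p Kp; rewrite /extend0 /=.
case: {-}_ / idP => [Kp'|//]; by rewrite (bool_irrelevance Kp' Kp).
Qed.

Lemma extend0_out p : ~~ K p -> extend0 x p = 0.
Proof. by rewrite /extend0; case: {-}_ / idP => // Kp; rewrite Kp. Qed.
End Extension.

(** * Posets in which the objects above a given one are the faces of a simplex *)

Section GradedByOrders.
Variables (disp : Order.disp_t) (P : porderType disp).
(* In the application ords [Q_0 < ... < Q_n] is the sequence of the orders |Q_i|. *)
Variables (deg : P -> nat) (ords : P -> seq nat).
(** The hypotheses that follow identify the objects above [q] with the non-empty subsequences of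
    [ords q]: by [ords_le] a face is determined by its orders, and [ords_face] supplies every
    face. *)
Hypothesis size_ords : forall p, size (ords p) = (deg p).+1.
Hypothesis ords_anti : forall p q, (p <= q)%O -> subseq (ords q) (ords p).
Hypothesis ords_le : forall q p p', (q <= p)%O -> (q <= p')%O ->
  subseq (ords p') (ords p) -> (p <= p')%O.
Hypothesis ords_face : forall q s, s != [::] -> subseq s (ords q) ->
  exists2 p, (q <= p)%O & ords p = s.

Hypothesis ords_sorted : forall p, sorted ltn (ords p).

Definition topord (p : P) : nat := last 0%N (ords p).

Lemma ords_rcons p : exists s, size s = deg p /\ ords p = rcons s (topord p).
Proof.
rewrite /topord; have := size_ords p; case/lastP: (ords p) => // s x.
by rewrite size_rcons last_rcons => -[sz]; exists s.
Qed.

Lemma ords_under_inj q p p' : (q <= p)%O -> (q <= p')%O ->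
  ords p = ords p' -> p = p'.
Proof.
by move=> qp qp' e; apply/le_anti/andP; split; apply: (@ords_le q); rewrite ?e.
Qed.

(** The cone over [r] with apex the top vertex of [q]: its orders are [ords r] followed by
    [topord q], and comparing lengths gives uniqueness. *)
Lemma top_cone q r : (q <= r)%O -> topord r <> topord q ->
  exists p, [/\ (q <= p <= r)%O, deg p = (deg r).+1, topord p = topord q &
    forall p', (q <= p' <= r)%O -> deg p' = (deg r).+1 -> topord p' = topord q ->
      p' = p].
Proof.
move=> qr ne; have [s [_ Eq]] := ords_rcons q; have [t [st Er]] := ords_rcons r.
have sub_rq : subseq (ords r) s.
  by move: (ords_anti qr); rewrite Eq Er subseq_rcons_rcons (negPf (introN eqP ne)).
have sub_q : subseq (rcons (ords r) (topord q)) (ords q).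
  by rewrite Eq subseq_rcons_rcons eqxx.
have [|p qp Ep] := ords_face _ sub_q; first by rewrite -size_eq0 size_rcons.
exists p; split.
- by rewrite qp (ords_le qp qr) // Ep subseq_rcons.
- by apply: succn_inj; rewrite -!size_ords Ep size_rcons.
- by rewrite {1}/topord Ep last_rcons.
- move=> p' /andP[qp' p'r] dp' tp'; apply: ords_under_inj qp' qp _; rewrite Ep.
  have [u [su Eu]] := ords_rcons p'; rewrite Eu tp'; congr rcons.
  have := ords_anti p'r; rewrite Eu {1}Er subseq_rcons_rcons tp'.
  rewrite (negPf (introN eqP ne)) -Er => /size_subseq_leqif[_].
  by rewrite size_ords su dp' eqxx => /esym/eqP.
Qed.

(** This is the facet opposite the top vertex; strict growth of [ords p] prevents [topord p] from
    being an order of that facet. *)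
Lemma top_base p n : deg p = n.+1 ->
  exists r, [/\ (p <= r)%O, deg r = n, topord r <> topord p &
    forall r', (p <= r')%O -> deg r' = n -> topord r' <> topord p -> r' = r].
Proof.
move=> dp; have [s [ss Ep]] := ords_rcons p; rewrite dp in ss.
have s0 : s != [::] by rewrite -size_eq0 ss.
have notop r : (p <= r)%O -> topord r <> topord p -> subseq (ords r) s.
  move=> /ords_anti + ne; have [t [_ ->]] := ords_rcons r.
  by rewrite Ep subseq_rcons_rcons (negPf (introN eqP ne)).
have uniq_p : uniq (ords p) := sorted_uniq ltn_trans ltnn (ords_sorted p).
have [|r pr Er] := @ords_face p s s0; first by rewrite Ep subseq_rcons.
have rn : deg r = n by apply: succn_inj; rewrite -size_ords Er ss.
exists r; split=> //.
  move=> e; move: uniq_p; rewrite Ep -Er rcons_uniq -e /topord.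
  by case: (ords r) (size_ords r) => // a t _; rewrite /= mem_last.
move=> r' pr' r'n /(notop r' pr') sub; apply: ords_under_inj pr' pr _; rewrite Er.
have := size_subseq_leqif sub; rewrite size_ords r'n ss => -[_].
by rewrite eqxx => /esym/eqP.
Qed.

Lemma top_vertex q : exists p, [/\ (q <= p)%O, deg p = 0%N, topord p = topord q &
  forall p', (q <= p')%O -> deg p' = 0%N -> topord p' = topord q -> p' = p].
Proof.
have [s [_ Eq]] := ords_rcons q.
have [//||p qp Ep] := @ords_face q [:: topord q].
  by rewrite sub1seq Eq mem_rcons mem_head.
exists p; split; rewrite ?qp //.
- by apply: succn_inj; rewrite -size_ords Ep.
- by rewrite {1}/topord Ep.
move=> p' qp' d0 tp'; apply: ords_under_inj qp' qp _; rewrite Ep.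
by have [[|a t] [sz ->]] := ords_rcons p'; rewrite tp' // d0 in sz *.
Qed.

(** * Values of a functor at the faces through the top vertex *)

Section Functor.
Variables (G : functor P) (n : nat).

(* G(q) is the product of its values at the n-dimensional faces of q through the
   top vertex of q. *)
Definition top_inj := forall q (x : G q),
  (forall p : over deg q n, topord (val p) = topord q -> diag x p = 0) -> x = 0.
Definition top_surj := forall q (y : prod_over deg G n q),
  exists x : G q, forall p : over deg q n, topord (val p) = topord q -> diag x p = y p.

(** Given [top_inj] and [top_surj], these families form a complement of the image of [diag], so each
    class in the cokernel has exactly one representative of this kind. *)
Definition off_top q (y : prod_over deg G n q) :=
  forall p : over deg q n, topord (val p) = topord q -> y p = 0.

Lemma off_top_inj q (y : prod_over deg G n q) :
  top_inj -> off_top y -> coker_pi (@diag _ _ deg G n q) y = 0 -> y = 0.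
Proof.
move=> inj y0; rewrite -(raddf0 (coker_pi (@diag _ _ deg G n q))) => /coker_piP[x].
rewrite subr0 => yE; rewrite yE (inj q x) ?raddf0 // => p /y0.
by rewrite yE.
Qed.

Lemma off_top_surj q (u : next_obj deg G n q) : top_surj ->
  exists2 y : prod_over deg G n q, off_top y & u = coker_pi (@diag _ _ deg G n q) y.
Proof.
move=> surj; have [x Ex] := surj q (repr u).
exists (repr u - diag x).
  by move=> p tp; rewrite dprodBE Ex // subrr.
by rewrite [LHS]coker_repr; apply/coker_piP; exists x; rewrite opprB addrC subrK.
Qed.

Lemma prod_over_eq q (y : prod_over deg G n q) r h h' :
  y (exist _ r h) = y (exist _ r h').
Proof. by rewrite (bool_irrelevance h h'). Qed.

End Functor.

(** Represent [x] by an off-top family [y]. For a face [r] missing the top vertex, restrict [y] to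
    the cone [p] over [r]: the restriction is off-top with zero class, hence zero, and so [y]
    vanishes at [r]. *)
Lemma top_inj_next G n :
  top_inj G n -> top_surj G n -> top_inj (next deg G n) n.+1.
Proof.
move=> inj surj q x x0; have [y y0 xE] := off_top_surj x surj.
suff y00 : y = 0 by rewrite xE y00 raddf0.
apply: functional_extensionality_dep => -[r hr].
have [tr|nt] := pselect (topord r = topord q); first exact: y0.
have /andP[qr /eqP dr] := hr.
have [p [/andP[qp pr] dp tp _]] := top_cone qr nt.
have hp : (q <= p)%O && (deg p == n.+1) by rewrite qp dp dr eqxx.
have hr' : (p <= r)%O && (deg r == n) by rewrite pr dr eqxx.
pose z := proj_over (over_le (exist _ p hp : over deg q n.+1)) y.
transitivity (z (exist _ r hr')); first exact: prod_over_eq.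
suff -> : z = 0 by [].
have := x0 (exist _ p hp) tp; rewrite xE /diag next_arr_pi.
by apply: (off_top_inj inj) => p' tp'; rewrite /z /proj_over y0 //= tp' tp.
Qed.

(** The prescribed classes have off-top representatives [y p]. A face [r] missing the top vertex
    lies in only one of the faces [p] involved, its cone, so the [y p] never conflict and glue to
    one family [z]. *)
Lemma top_surj_next G n :
  top_inj G n -> top_surj G n -> top_surj (next deg G n) n.+1.
Proof.
move=> inj surj q Y.
have cofY (p : over deg q n.+1) : exists y : prod_over deg G n (val p),
    off_top y /\ Y p = coker_pi (@diag _ _ deg G n (val p)) y.
  by have [y y0 yE] := off_top_surj (Y p) surj; exists y.
pose y p := projT1 (cid (cofY p)).
have yP p : off_top (y p) /\ Y p = coker_pi (@diag _ _ deg G n (val p)) (y p).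
  by rewrite /y; case: cid.
have glue (r : over deg q n) : exists z : G (val r),
    (topord (val r) = topord q -> z = 0) /\
    forall (p : over deg q n.+1) (h : (val p <= val r)%O && (deg (val r) == n)),
      topord (val p) = topord q -> z = y p (exist _ (val r) h).
  have [tr|nt] := pselect (topord (val r) = topord q).
    by exists 0; split=> // p h tp; rewrite (yP p).1 //= tr tp.
  have /andP[qr /eqP dr] := valP r.
  have [p [/andP[qp pr] dp tp p_uniq]] := top_cone qr nt.
  have hp : (q <= p)%O && (deg p == n.+1) by rewrite qp dp dr eqxx.
  have hr : (p <= val r)%O && (deg (val r) == n) by rewrite pr dr eqxx.
  exists (y (exist _ p hp) (exist _ (val r) hr)); split=> // -[p' hp'] /= h' tp'.
  have /andP[qp' /eqP dp'] := hp'; have /andP[pr' _] := h'.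
  have ep : p' = p by apply: p_uniq => //; rewrite ?qp' // dp' dr.
  subst p'; rewrite (bool_irrelevance hp' hp); exact: prod_over_eq.
pose z : prod_over deg G n q := fun r => projT1 (cid (glue r)).
have zP r : (topord (val r) = topord q -> z r = 0) /\
    forall (p : over deg q n.+1) (h : (val p <= val r)%O && (deg (val r) == n)),
      topord (val p) = topord q -> z r = y p (exist _ (val r) h).
  by rewrite /z; case: cid.
exists (coker_pi (@diag _ _ deg G n q) z) => p tp.
rewrite /diag next_arr_pi (yP p).2; congr (coker_pi _ _).
apply: functional_extensionality_dep => -[r hr].
exact: (zP (over_mono (over_le p) (exist _ r hr))).2.
Qed.

Lemma top_bij_Fn n : top_inj (Fn deg n) n /\ top_surj (Fn deg n) n.
Proof.
elim: n => [|n [inj surj]]; last first.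
  by split; [apply: top_inj_next | apply: top_surj_next].
(* In degree 0 the only face through the top vertex is that vertex, where [diag] is the identity. *)
split=> q x; have [p [qp dp tp p_uniq]] := top_vertex q;
  have hp : (q <= p)%O && (deg p == 0%N) by rewrite qp dp.
  by move/(_ (exist _ p hp) tp).
exists (x (exist _ p hp)) => -[p' hp'] /= tp'.
have /andP[qp' /eqP dp'] := hp'; have ep := p_uniq _ qp' dp' tp'.
by subst p'; rewrite (bool_irrelevance hp hp').
Qed.

(** An off-top family on the facets of [p] is determined by its value at the facet [r] opposite the
    top vertex, so a generator at [r] yields a generator one degree higher. *)
Lemma Fn_cyclic n p : deg p = n -> exists g : Fn deg n p,
  (forall x, exists c : int, x = g *~ c) /\ (forall c : int, g *~ c = 0 -> c = 0).
Proof.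
elim: n p => [|n IH] p dp.
  exists (1 : int); split=> [x|c]; first by exists x; rewrite intz.
  by rewrite intz.
have [r [pr dr nt r_uniq]] := top_base dp; have [inj surj] := top_bij_Fn n.
have hr : (p <= r)%O && (deg r == n) by rewrite pr dr eqxx.
pose gen (s : over deg p n) (g : Fn deg n (val s)) :=
  (forall x, exists c : int, x = g *~ c) /\ (forall c : int, g *~ c = 0 -> c = 0).
have exg (s : over deg p n) : exists g, gen s g.
  by apply: IH; have /andP[_ /eqP] := valP s.
pose y : prod_over deg (Fn deg n) n p := fun s =>
  if topord (val s) == topord p then 0 else projT1 (cid (exg s)).
have y0 : off_top y by move=> s ts; rewrite /y ts eqxx.
have yM c s : (y *~ c) s = y s *~ c := dprodMzE y c s.
have [gen_r free_r] : gen (exist _ r hr) (y (exist _ r hr)).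
  by rewrite /y (introF eqP nt); case: cid.
exists (coker_pi (@diag _ _ deg (Fn deg n) n p) y); split=> [u|c].
  have [z z0 ->] := off_top_surj u surj.
  have [c zE] := gen_r (z (exist _ r hr)).
  exists c; rewrite -raddfMz; congr (coker_pi _ _).
  apply: functional_extensionality_dep => s; rewrite yM.
  have [ts|nts] := pselect (topord (val s) = topord p).
    by rewrite z0 // y0 // mul0rz.
  case: s nts => s hs /= nts; have /andP[ps /eqP ds] := hs.
  by have es := r_uniq s ps ds nts; subst s; rewrite (bool_irrelevance hs hr).
rewrite -raddfMz => /(off_top_inj inj) yc0; apply: free_r; rewrite -yM yc0 //.
by move=> s ts; rewrite yM y0 // mul0rz.
Qed.

(** * Covering families from a triangular matching *)

Section Covering.
Variable K : forall n, pred (Ob deg n).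
Variable N : nat.
Hypothesis topord_le : forall p, (topord p <= N)%N.

Lemma facet_off_top n (x : Ob deg n) (t : Ob deg n.+1) :
  (val t <= val x)%O -> topord (val x) <> topord (val t) ->
  forall p : over deg (val t) n, topord (val p) <> topord (val t) ->
  over_Ob p = x.
Proof.
move=> tx ne p nep; apply: val_inj => /=.
have [r [_ _ _ r_uniq]] := top_base (eqP (valP t)).
have /andP[tp /eqP dp] := valP p.
by rewrite (r_uniq _ tp dp nep) (r_uniq _ tx (eqP (valP x)) ne).
Qed.

Section Degree.
Local Notation offK n := {x : Ob deg n | predC (@K n) x}.
Variables (n : nat) (up : offK n -> Ob deg n.+1).
Hypothesis up_le : forall x, (val (up x) <= val (val x))%O.
Hypothesis up_lt : forall x, (topord (val (val x)) < topord (val (up x)))%N.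

Let up_faces x (p : over deg (val (up x)) n) :
  topord (val p) = topord (val (up x)) \/ over_Ob p = val x.
Proof.
have [tp|ntp] := pselect (topord (val p) = topord (val (up x))); first by left.
right; apply: facet_off_top ntp; first exact: up_le.
by apply/eqP; rewrite neq_ltn up_lt.
Qed.

(* With respect to the order of the top subgroup, the matrix of d_n with rows
   indexed by the [up x] is triangular with isomorphisms on the diagonal. *)
Lemma dn_up_inj (X : prod_Ob deg n) :
  (forall x, @K n x -> X x = 0) -> (forall x, dn X (up x) = 0) -> X = 0.
Proof.
move=> XK dX; apply: functional_extensionality_dep.
have [inj _] := top_bij_Fn n.
(* Descending induction on [topord]: the claim is empty for [k = 0] and covers every [x] for
   [k = N.+1]. *)
suff IH k x : (N < topord (val x) + k)%N -> X x = 0.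
  by move=> x; apply: (IH N.+1); rewrite addnS ltnS leq_addl.
elim: k x => [|k IH] x lt_k.
  by have := topord_le (val x); rewrite leqNgt -[topord _]addn0 lt_k.
have [/XK//|nKx] := boolP (@K n x); pose z := exist _ x nKx : offK n.
have hx : (val (up z) <= val x)%O && (deg (val x) == n) by rewrite (up_le z) (valP x).
(* Faces of [up z] through its top vertex have larger [topord] than [x], so [X] already vanishes on
   them. *)
have y0 : off_top (fun p : over deg (val (up z)) n => X (over_Ob p)).
  move=> p tp; apply: (IH (over_Ob p)); rewrite /= tp; apply: leq_trans lt_k _.
  by rewrite addnS -addSn leq_add2r; apply: up_lt.
pose px : over deg (val (up z)) n := exist _ (val x) hx.
have : X (over_Ob px) = 0 :=
  congr1 (fun y : prod_over deg (Fn deg n) n _ => y px) (off_top_inj inj y0 (dX z)).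
by have -> : over_Ob px = x by apply: val_inj.
Qed.

(** Back substitution in descending order of [topord]. A correction supported where [topord + k = N]
    leaves the rows solved earlier unchanged, because the relevant faces of those [up x] all have
    larger [topord]. *)
Lemma dn_up_surj (Y : prod_Ob deg n.+1) : exists X : prod_Ob deg n,
  (forall x, @K n x -> X x = 0) /\ (forall x, dn X (up x) = Y (up x)).
Proof.
have [_ surj] := top_bij_Fn n.
suff above k : exists X : prod_Ob deg n, (forall x, @K n x -> X x = 0) /\
    forall x, (N < topord (val (val x)) + k)%N -> dn X (up x) = Y (up x).
  have [X [XK dX]] := above N.+1.
  by exists X; split=> // x; apply: dX; rewrite addnS ltnS leq_addl.
elim: k => [|k [X [XK dX]]].
  exists 0; split=> // x; have := topord_le (val (val x)).
  by rewrite addn0 => le_N /leq_trans/(_ le_N); rewrite ltnn.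
have exy x : exists y : prod_over deg (Fn deg n) n (val (up x)),
    off_top y /\ Y (up x) - dn X (up x) = coker_pi (@diag _ _ deg (Fn deg n) n _) y.
  by have [y y0 yE] := off_top_surj (Y (up x) - dn X (up x)) surj; exists y.
pose y x := projT1 (cid (exy x)).
have yP x : off_top (y x) /\
    Y (up x) - dn X (up x) = coker_pi (@diag _ _ deg (Fn deg n) n _) (y x).
  by rewrite /y; case: cid.
have hx (x : offK n) :
    (val (up x) <= val (val x))%O && (deg (val (val x)) == n).
  by rewrite up_le (valP (val x)).
(* The defect in row [up x] has an off-top representative [y x], which can be non-zero only at the
   facet [x]; its value there is the correction. *)
pose d : prod_in (predC (@K n)) := fun x =>
  if (topord (val (val x)) + k == N)%N then y x (exist _ (val (val x)) (hx x)) else 0.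
have dE x h : extend0 d (exist _ (val (val x)) h) = d x.
  case: x h => -[v hv] hK h; rewrite (bool_irrelevance h hv); exact: extend0_in.
have d0 w : (topord (val w) + k != N)%N -> extend0 d w = 0.
  move=> ne; have [Kw|nKw] := boolP (@K n w); first by rewrite extend0_out // /= Kw.
  have := extend0_in d (exist _ w nKw : offK n).
  by rewrite /d /= (negPf ne).
have d_top x p : (N < topord (val (val x)) + k.+1)%N ->
    topord (val p) = topord (val (up x)) ->
    extend0 d (over_Ob (p : over deg (val (up x)) n)) = 0.
  move=> lt_k tp; apply: d0; rewrite /= tp neq_ltn; apply/orP; right.
  by apply: leq_trans lt_k _; rewrite addnS -addSn leq_add2r; apply: up_lt.
exists (X + extend0 d); split=> [x Kx|x lt_k].
  by rewrite dprodDE XK // extend0_out ?addr0 //= Kx.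
rewrite raddfD dprodDE /=; have [lt_k'|le_k] := ltnP N (topord (val (val x)) + k).
  rewrite dX // (@dn_coker_pi _ _ _ _ _ _ 0) ?raddf0 ?addr0 // => p.
  have [/d_top->//|ep] := up_faces p.
  by rewrite (d0 (over_Ob p)) // ep neq_ltn lt_k' orbT.
suff -> : dn (extend0 d) (up x) = Y (up x) - dn X (up x) by rewrite addrC subrK.
rewrite (yP x).2; apply: dn_coker_pi => p.
have [tp|/(congr1 val)/= ep] := up_faces p; first by rewrite d_top // (yP x).1.
have -> : p = exist _ (val (val x)) (hx x) by apply: val_inj.
by rewrite [LHS]dE /d ifT // eqn_leq le_k -ltnS -addnS.
Qed.

Hypothesis up_K : forall x, @K n.+1 (up x).

(** Each class has a unique representative vanishing at all [up x]: it exists by [dn_up_surj], and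
    it is unique because [dn_up_inj] kills any image element vanishing there. What remains is one
    infinite cyclic coordinate for each unmatched [t]. *)
Lemma pure_dK (e : seq (Ob deg n.+1)) : (forall t, t \in e) -> pure (dK K n).
Proof.
move=> e_full; pose onK := {t : Ob deg n.+1 | @K n.+1 t}.
pose unmatched (t : onK) := `[< forall x, up x <> val t >].
pose L := {t : onK | unmatched t}.
have exg (t : onK) := Fn_cyclic (eqP (valP (val t))).
pose g t := projT1 (cid (exg t)).
have gP t : (forall x, exists c : int, x = g t *~ c) /\
    (forall c : int, g t *~ c = 0 -> c = 0) by rewrite /g; case: cid.
pose Y (a : L -> int) : prod_in (@K n.+1) := fun t =>
  g t *~ (if insub t is Some l then a l else 0).
have YL a (l : L) : Y a (val l) = g (val l) *~ a l by rewrite /Y valK.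
have Yup a t : ~~ unmatched t -> Y a t = 0 by move=> nt; rewrite /Y insubN.
have dKE x t : dK K n x t = dn (extend0 x) (val t) by [].
have dK_inj x : (forall t, ~~ unmatched t -> dK K n x t = 0) -> dK K n x = 0.
  move=> dx0; apply: functional_extensionality_dep => t.
  rewrite dKE (@dn_up_inj (extend0 x)) ?raddf0 //.
    by move=> y Ky; rewrite extend0_out //= Ky.
  move=> y; apply: (dx0 (exist _ (up y) (up_K y))).
  by apply/asboolPn => /(_ y).
apply: (@free_abelian_fin L (pmap insub (pmap insub e))
         _ (fun a => coker_pi (dK K n) (Y a))).
- by move=> l; rewrite !mem_pmap_sub.
- move=> a b; rewrite -raddfB; congr (coker_pi _ _).
  apply: functional_extensionality_dep => t; rewrite dprodBE /Y -mulrzBr.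
  by case: insub => // ; rewrite subrr.
- move=> a b /coker_piP[x abE] l; apply/eqP; rewrite -subr_eq0; apply/eqP.
  apply: (gP (val l)).2; rewrite mulrzBr -!YL.
  have ab0 : Y a - Y b = 0.
    by rewrite abE dK_inj // => t nt; rewrite -abE dprodBE !Yup // subrr.
  exact: (congr1 (fun u : prod_in (@K n.+1) => u (val l)) ab0).
move=> v; pose y : prod_in (@K n.+1) := repr v.
have [X [XK dX]] := dn_up_surj (extend0 y).
pose x : prod_in (predC (@K n)) := restrict X.
have xE : extend0 x = X.
  apply: functional_extensionality_dep => p; have [Kp|nKp] := boolP (@K n p).
    by rewrite extend0_out /= ?Kp // XK.
  exact: (extend0_in x (exist _ p nKp)).
(* Subtracting the image of [x] clears [y] at every matched [t]. *)
pose w := y - dK K n x.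
have w_up t : ~~ unmatched t -> w t = 0.
  move=> /asboolPn/existsNP[z /contrapT upz].
  have dXt : dn X (val t) = extend0 y (val t) by rewrite -upz dX.
  by rewrite /w dprodBE dKE xE dXt extend0_in subrr.
have exc (l : L) := (gP (val l)).1 (w (val l)).
pose a l := projT1 (cid (exc l)); exists a.
transitivity (coker_pi (dK K n) y); first by rewrite /coker_pi /= reprK.
apply/coker_piP; exists x; suff -> : Y a = w by rewrite opprB addrC subrK.
apply: functional_extensionality_dep => t.
have [ut|nut] := boolP (unmatched t); last by rewrite Yup // w_up.
by rewrite (YL _ (exist _ t ut)) /a; case: cid.
Qed.

End Degree.

(** For injectivity, the difference [z] of two compatible families restricts on the faces of [up p]
    to a value of [diag], so [dn] kills it and [dn_up_inj] applies in degree [n]. *)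
Theorem global_covering_family_of_up :
  (forall n, exists e : seq (Ob deg n), forall x, x \in e) ->
  (forall n (x : Ob deg n), ~~ @K n x -> exists t : Ob deg n.+1,
    [/\ @K n.+1 t, (val t <= val x)%O & (topord (val x) < topord (val t))%N]) ->
  global_covering_family K.
Proof.
move=> Ob_fin up_ex.
have up_exP n : exists up : {x : Ob deg n | predC (@K n) x} -> Ob deg n.+1,
    [/\ forall x, @K n.+1 (up x), forall x, (val (up x) <= val (val x))%O
      & forall x, (topord (val (val x)) < topord (val (up x)))%N].
  pose up (x : {x : Ob deg n | predC (@K n) x}) :=
    projT1 (cid (up_ex n (val x) (valP x))).
  by exists up; split=> x; rewrite /up; case: cid => t [].
split=> n; have [up [up_K up_le up_lt]] := up_exP n; last first.
  by have [e e_full] := Ob_fin n.+1; apply: (pure_dK up_le up_lt up_K e_full).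
move=> [x xc] [y yc] xy; suff xyE : x = y.
  by subst y; rewrite (Prop_irrelevance xc yc).
pose z := x - y.
have zc p q (h : (p <= q)%O) : farr (Fn deg n) h (z p) = z q.
  by rewrite /z !dprodBE raddfB xc yc.
pose Z : prod_Ob deg n := fun p => z (val p).
have Z0 : Z = 0.
  apply: (dn_up_inj up_le up_lt) => [p Kp|p].
    have /= e := congr1 (fun u : prod_in (@K n) => u (exist _ p Kp)) xy.
    by apply/eqP; rewrite subr_eq0; apply/eqP.
  rewrite (@dn_coker_pi _ _ _ _ _ _ (diag (z (val (up p))))) => [|r].
    rewrite -[RHS](raddf0 (coker_pi (@diag _ _ deg (Fn deg n) n _))).
    by apply/coker_piP; exists (z (val (up p))); rewrite subr0.
  by rewrite /diag zc.
(* By [top_inj], the values in degree [n] determine a compatible family in all degrees. *)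
apply/eqP; rewrite -subr_eq0; apply/eqP; apply: functional_extensionality_dep => p.
have [inj _] := top_bij_Fn n; apply: inj => r _; rewrite /diag zc.
exact: (congr1 (fun u : prod_Ob deg n => u (over_Ob r)) Z0).
Qed.
End Covering.
End GradedByOrders.

(** * Chains of subgroups and their orders *)

Section Chains.
Variables (gT : finGroupType) (S : {group gT}) (F : fusion_system S).
Implicit Types (c d : chain S) (x y : chain_class F).
Local Open Scope group_scope.
Local Open Scope quotient_scope.

Local Notation card_seq s := [seq #|(Q : {set gT})| | Q : {group gT} <- s].

Definition chain_ords x : seq nat := card_seq (repr x : chain S).

Lemma chain_piP c d : \pi_(chain_class F) c = \pi d <-> chain_iso F c d.
Proof. by split=> [/eqP/chain_classP|/chain_classP/eqP]. Qed.

Lemma card_hom_im P Q f (R : {group gT}) :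
  Hom F P Q f -> R \subset P -> #|f @: R| = #|R|.
Proof.
case/hom_inj=> _ f_inj _ sRP; apply: card_in_imset.
by move=> u v Ru Rv; apply: f_inj; apply: (subsetP sRP).
Qed.

Lemma chain_iso_ords c d : chain_iso F c d -> card_seq c = card_seq d.
Proof.
case=> f [Hf _] /(congr1 (map (fun A : {set gT} => #|A|))); rewrite -!map_comp => <-.
by apply/eq_in_map => Q cQ /=; rewrite (card_hom_im Hf) ?top_max.
Qed.

Lemma chain_ords_pi c : chain_ords (\pi c) = card_seq c.
Proof. by apply/chain_iso_ords/chain_piP; rewrite reprK. Qed.

Lemma size_chain_ords x : size (chain_ords x) = (chain_deg x).+1.
Proof.
rewrite size_map prednK // lt0n size_eq0; by have /and4P[] := chainP (repr x).
Qed.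

Lemma card_seq_sorted c : sorted ltn (card_seq c).
Proof.
have /and4P[_ c_sorted _ _] := chainP c.
by rewrite sorted_map; apply: sub_sorted c_sorted => P Q; apply: proper_card.
Qed.

Lemma mem_top c : top c \in (c : seq _).
Proof.
have /and4P[+ _ _ _] := chainP c.
by rewrite /top; case: (c : seq _) => // Q s _; rewrite /= mem_last.
Qed.

(** Transporting the subchain along an isomorphism allows the larger chain to be prescribed, whereas
    [chain_le] chooses both representatives. *)
Lemma chain_le_pi x c : chain_le x (\pi_(chain_class F) c) ->
  exists2 d, x = \pi d & subseq d c.
Proof.
move=> /asboolP[d [c' [-> /esym/chain_piP[f If fc'c] /subseqP[m szm dE]]]].
have sE : [seq f @: (Q : {set gT}) | Q : {group gT} <- d]
    = [seq (Q : {set gT}) | Q : {group gT} <- mask m c].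
  by rewrite dE !map_mask fc'c.
have d0 : (d : seq _) != [::] by have /and4P[] := chainP d.
have s0 : mask m c != [::].
  apply: contraNneq d0 => s0; move: (congr1 size sE).
  by rewrite s0 /= size_map => /size0nil->.
exists (Chain (subchain s0 (mask_subseq m c))); last exact: mask_subseq.
apply/chain_piP; exists f => //; apply: (isoF_restr If); last exact: top_map sE.
by apply/top_max/(mem_subseq (mask_subseq m c')); rewrite -dE mem_top.
Qed.

Lemma chain_ords_anti x y : chain_le y x -> subseq (chain_ords y) (chain_ords x).
Proof.
by move=> /asboolP[c [d [-> -> cd]]]; rewrite !chain_ords_pi map_subseq.
Qed.

(** Inside one chain a subgroup is determined by its order, so inclusion of the orders of two
    subchains gives inclusion of the subchains. *)
Lemma chain_ords_le z x y : chain_le x z -> chain_le y z ->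
  subseq (chain_ords y) (chain_ords x) -> chain_le y x.
Proof.
rewrite -[z]reprK => /chain_le_pi[a -> ac] /chain_le_pi[b -> bc].
rewrite !chain_ords_pi => sub_ba; apply/asboolP; exists b, a; split=> //.
set c := repr z in ac bc.
have card_uniq : uniq (card_seq c) := sorted_uniq ltn_trans ltnn (card_seq_sorted c).
have c_uniq := map_uniq card_uniq.
have b_a Q : Q \in (b : seq _) -> Q \in (a : seq _).
  move=> bQ; have /mapP[Q' aQ' eQ] : #|Q| \in card_seq a.
    by apply: (mem_subseq sub_ba); apply: map_f.
  suff -> : Q = Q' by [].
  have cQ := mem_subseq bc bQ; have cQ' := mem_subseq ac aQ'.
  exact: (uniq_map_inj card_uniq cQ cQ' eQ).
move/(subseq_uniqP c_uniq): ac => ->; move/(subseq_uniqP c_uniq): bc => ->.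
(* Both subchains are filters of the duplicate-free [c]; by [b_a], a further filtering of [a] gives
   [b]. *)
rewrite -(eq_filter (a1 := predI (mem (b : seq _)) (mem (a : seq _)))).
  by rewrite filter_predI filter_subseq.
by move=> Q /=; apply: andb_idr; apply: b_a.
Qed.

Lemma chain_ords_face y s : s != [::] -> subseq s (chain_ords y) ->
  exists2 x, chain_le x y & chain_ords x = s.
Proof.
move=> s0 /subseqP[m szm]; rewrite -map_mask => sE.
have s0' : mask m (repr y) != [::] by apply: contraNneq s0 => e; rewrite sE e.
pose a := Chain (subchain s0' (mask_subseq m (repr y))).
exists (\pi a); last by rewrite chain_ords_pi sE.
by apply/asboolP; exists a, (repr y); rewrite reprK mask_subseq.
Qed.

Lemma topord_pi c : topord chain_ords (\pi c) = #|top c|.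
Proof.
rewrite /topord chain_ords_pi /top.
by have /and4P[+ _ _ _] := chainP c; case: (c : seq _) => //= Q s _; rewrite last_map.
Qed.

Lemma topord_chain_le x : (topord chain_ords x <= #|S|)%N.
Proof. by rewrite -[x]reprK topord_pi subset_leq_card ?top_sub. Qed.

Lemma Ob_chain_enum n : exists e : seq (Ob (@chain_poset_deg gT S F) n),
  forall t, t \in e.
Proof.
pose chains : seq (chain S) := pmap insub [seq tval u | u : n.+1.-tuple {group gT}].
exists (pmap insub [seq \pi_(chain_class F) c | c <- chains]) => t.
rewrite mem_pmap_sub -[val t]reprK map_f // mem_pmap_sub.
have sz : size (repr (val t) : chain S) == n.+1.
  rewrite -(size_map (fun Q : {group gT} => #|Q|)) size_chain_ords eqSS; exact: valP t.
by apply/imageP; exists (Tuple sz).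
Qed.

(** * Appending the intersection of the normalizers *)

Lemma top_rcons (s : seq {group gT}) Q : top (rcons s Q) = Q.
Proof. by rewrite /top last_rcons. Qed.

Lemma group_set_capN (s : seq {group gT}) : group_set (\bigcap_(Q <- s) 'N_S(Q)).
Proof.
elim: s => [|Q s IH]; first by rewrite big_nil; apply: groupP.
by rewrite big_cons; exact: (groupP ('N_S(Q) :&: Group IH)).
Qed.
Definition capN s : {group gT} := Group (group_set_capN s).

Lemma sub_capN (A : {set gT}) (s : seq {group gT}) :
  (A \subset capN s) = all (fun Q : {group gT} => A \subset 'N_S(Q)) s.
Proof.
rewrite /=; elim: s => [|Q s IH]; first by rewrite big_nil subsetT.
by rewrite big_cons subsetI IH.
Qed.

Lemma capN_rcons s Q : capN (rcons s Q) = capN s :&: 'N_S(Q) :> {set gT}.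
Proof. by rewrite /= -cats1 big_cat big_seq1. Qed.

Lemma top_sub_capN c : top c \subset capN c.
Proof.
rewrite sub_capN; apply/allP => Q cQ; rewrite subsetI top_sub //=.
by have /and4P[_ _ /allP/(_ Q cQ)/normal_norm] := chainP c.
Qed.

(** Each member of [c] lies in [top c], hence in [capN c], which normalizes it. *)
Lemma is_chain_rcons_capN c :
  top c != capN c :> {set gT} -> is_chain S (rcons c (capN c)).
Proof.
move=> ne; have /and4P[c0 c_sorted _ _] := chainP c.
have nsN Q : Q \in (c : seq _) -> capN c \subset 'N_S(Q).
  by move: (subxx (capN c)); rewrite {2}/capN sub_capN => /allP; apply.
have topN : top c \proper capN c by rewrite properEneq ne top_sub_capN.
rewrite /is_chain top_rcons; apply/and4P; split.
- by rewrite -size_eq0 size_rcons.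
- move: c_sorted topN; rewrite /top; case: (c : seq _) c0 => //= Q s _.
  by rewrite rcons_path => -> ->.
- rewrite all_rcons normal_refl; apply/allP => Q cQ; rewrite /normal.
  rewrite (subset_trans (top_max cQ) (top_sub_capN c)).
  by apply: subset_trans (nsN Q cQ) (subsetIr _ _).
- by apply: subset_trans (nsN _ (mem_top c)) (subsetIl _ _).
Qed.

(** Restricting the isomorphism to [top c] shows that a conjugate of an extension of [c] extends a
    conjugate of [c]. *)
Lemma chain_iso_rcons c d (Q : {group gT}) (cQ : is_chain S (rcons c Q)) :
  chain_iso F (Chain cQ) d -> exists d' D,
    [/\ (d : seq _) = rcons (d' : chain S) D, chain_iso F c d' & #|D| = #|Q|].
Proof.
case=> f If; case: d If => s s_chain /=; rewrite top_rcons.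
case/lastP: s s_chain => [|s D] sD; first by case: (c : seq _).
rewrite top_rcons !map_rcons => If E.
have [sE DE] := rcons_inj E.
have c0 : (c : seq _) != [::] by have /and4P[] := chainP c.
have s0 : s != [::].
  apply: contraNneq c0 => s0; move: (congr1 size sE).
  by rewrite s0 /= size_map => /size0nil->.
exists (Chain (@subchain gT S (Chain sD) s s0 (subseq_rcons s D))), D; split=> //.
  exists f => //; apply: (isoF_restr If); last exact: top_map sE.
  have := @top_max _ _ (Chain cQ) (top c); rewrite /= top_rcons; apply.
  by rewrite mem_rcons inE mem_top orbT.
by rewrite -DE (card_hom_im If.1).
Qed.

(* Among the chains representing x, pick one for which N = \bigcap_i N_S(Q_i) is
   largest, and append N.  Any conjugate of the new chain arises from a conjugate
   (Q'_i) of the old one by appending a subgroup of order #|N|, contained in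
   \bigcap_i N_S(Q'_i), hence equal to it by maximality. *)
Lemma chain_K_up n (x : Ob (@chain_poset_deg gT S F) n) : ~~ chain_K x ->
  exists t : Ob (@chain_poset_deg gT S F) n.+1,
    [/\ chain_K t, chain_le (val x) (val t)
      & (topord chain_ords (val x) < topord chain_ords (val t))%N].
Proof.
move=> /asboolPn/existsNP[c0 /not_implyP[c0x c0N]].
pose P k := `[< exists2 c, \pi_(chain_class F) c = val x & #|capN c| = k >].
have exP : exists k, P k by exists #|capN c0|; apply/asboolP; exists c0.
have ubP k : P k -> (k <= #|gT|)%N by move=> /asboolP[c _ <-]; apply: max_card.
case: (ex_maxnP exP ubP) => k /asboolP[c cx ck] k_max.
have topc : topord chain_ords (val x) = #|top c| by rewrite -cx topord_pi.
(* Only [c0] is known to have top different from the intersection; the common order of the tops and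
   the maximality of [k] carry the strict inequality over to [c]. *)
have lt_top : (#|top c| < #|capN c|)%N.
  have c0_proper : top c0 \proper capN c0.
    by rewrite properEneq top_sub_capN andbT; apply/eqP => /esym.
  rewrite -topc -c0x topord_pi (leq_trans (proper_card c0_proper)) // ck.
  by apply: k_max; apply/asboolP; exists c0.
have cN : is_chain S (rcons c (capN c)).
  by apply: is_chain_rcons_capN; apply: contraTneq lt_top => ->; rewrite ltnn.
pose t := \pi_(chain_class F) (Chain cN).
have szc : size c = n.+1.
  have := eqP (valP x); rewrite -cx /chain_poset_deg chain_degE => <-.
  by rewrite prednK // lt0n size_eq0; have /and4P[] := chainP c.
have t_deg : chain_poset_deg (t : chain_poset F) == n.+1.
  by rewrite /chain_poset_deg chain_degE /= size_rcons szc.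
exists (exist _ t t_deg); split => /=.
- apply/asboolP => d /esym/chain_piP/chain_iso_rcons[d' [D [dE cd' cardD]]].
  have D_top : D = top d by rewrite dE top_rcons.
  have D_sub : D \subset capN d' :&: 'N_S(D).
    by rewrite -capN_rcons -dE {1}D_top top_sub_capN.
  have DN : D = capN d' :> {set gT}.
    apply/eqP; rewrite eqEcard (subset_trans D_sub (subsetIl _ _)) cardD ck.
    by apply: k_max; apply/asboolP; exists d' => //; rewrite -cx; apply/esym/chain_piP.
  rewrite -[LHS]/(capN d : {set gT}) -D_top dE capN_rcons -DN.
  by apply/setIidPl; apply: subset_trans D_sub (subsetIr _ _).
- by apply/asboolP; exists c, (Chain cN); rewrite -cx subseq_rcons.
- by rewrite topc topord_pi /= top_rcons.
Qed.
End Chains.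

Theorem lemma8p4 (p : nat) (gT : finGroupType) (S : {group gT})
    (F : fusion_system S) (p_prime : prime p) (pS : (p.-group S)%g)
    (F_sat : saturated F p) :
  global_covering_family (@chain_K gT S F).
Proof.
apply: (@global_covering_family_of_up _ (chain_poset F) (@chain_poset_deg gT S F)
  (@chain_ords gT S F) _ _ _ _ _ _ #|S|).
- exact: size_chain_ords.
- by move=> x y; apply: chain_ords_anti.
- by move=> z x y; apply: chain_ords_le.
- exact: chain_ords_face.
- by move=> x; apply: card_seq_sorted.
- exact: topord_chain_le.
- exact: Ob_chain_enum.
- exact: chain_K_up.
Qed.
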